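(* Let $\Phi$ be a finite range defining potential and $\mathbb P$ the distribution of the disorder variables. Let $K^{\bar\sigma}$ and $K^{\bar\sigma'}$ be two joint measures for the same quenched Gibbs specification $\mu_\Lambda^{\cdot}[\eta](d\sigma)$ (i.e. with the same $\Phi$ and $\mathbb P$), obtained with any two spin boundary conditions $\bar\sigma$ and $\bar\sigma'$ respectively, along any sequences $\Lambda_N$ and $\Lambda'_N$ of volumes respectively. Then their relative entropy density vanishes: $$h(K^{\bar\sigma}|K^{\bar\sigma'})=0.$$ (No translation invariance, not even of $\Phi$, and no independence or decoupling of $\mathbb P$ is assumed.)
   Context: $E,E'$ are finite sets. Spin configurations are $\sigma\in E^{\mathbb Z^d}$, disorder configurations are $\eta\in(E')^{\mathbb Z^d}$, joint configurations are $\xi=(\sigma,\eta)=(\sigma_x,\eta_x)_{x\in\mathbb Z^d}$. The defining potential is a family $\Phi=(\Phi_A)$ of real functions indexed by finite $A\subset\mathbb Z^d$, with $\Phi_A(\xi)$ depending on $\xi$ only through $\xi_A$; it is finite range, i.e. there is $r<\infty$ with $\Phi_A=0$ whenever $\mathrm{diam}(A)>r$. For fixed $\eta$, finite $\Lambda$ and boundary condition $\bar\sigma\in E^{\mathbb Z^d}$ the quenched finite-volume Gibbs measure is $$\mu_\Lambda^{\bar\sigma}[\eta](B)=\frac1{Z_\Lambda^{\bar\sigma}[\eta]}\sum_{\sigma_\Lambda\in E^\Lambda}1_B(\sigma_\Lambda\bar\sigma_{\mathbb Z^d\setminus\Lambda})\exp\Big(-\sum_{A:A\cap\Lambda\ne\emptyset}\Phi_A(\sigma_\Lambda\bar\sigma_{\mathbb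 Z^d\setminus\Lambda},\eta)\Big).$$ $\mathbb P$ is a probability measure on $(E')^{\mathbb Z^d}$. A joint measure $K^{\bar\sigma}$ is any weak limit (product topology), along a sequence of finite volumes $\Lambda_N\uparrow\mathbb Z^d$, of the measures $\mathbb P(d\eta)\mu_{\Lambda_N}^{\bar\sigma}[\eta](d\sigma)$. For probability measures $K,K'$ on the joint space, $h(K|K')=\lim_{n\to\infty}|\Lambda_n|^{-1}h_{\Lambda_n}(K|K')$ with $\Lambda_n=[-n,n]^d\cap\mathbb Z^d$, where $h_\Lambda(K|K')=\sum_{\xi_\Lambda}K(\xi_\Lambda)\log\frac{K(\xi_\Lambda)}{K'(\xi_\Lambda)}$ if the marginal of $K$ on $\Lambda$ is absolutely continuous with respect to that of $K'$, and $+\infty$ otherwise; $K(\xi_\Lambda)$ denotes the probability of the cylinder determined by $\xi_\Lambda$.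
   Formalization: The potential is additionally assumed uniformly bounded (the sup over A and ξ of |Φ_A(ξ)| is finite); without this the claim fails, e.g. for an Ising chain with couplings growing like x², whose + and − states have infinite relative entropy density. *)

(* Defs.v *)
From HB Require Import structures.
From mathcomp Require Import all_boot all_order all_algebra finmap.
From mathcomp Require Import all_classical all_reals all_analysis.

Set Implicit Arguments.
Unset Strict Implicit.
Unset Printing Implicit Defensive.

Import Order.TTheory GRing.Theory Num.Theory.
Import numFieldNormedType.Exports.

Local Open Scope classical_set_scope.
Local Open Scope ring_scope.

Notation Zd d := {ffun 'I_d -> int}.

(* Nonempty finite sets.  The distinguished point carries no content: it is
   there because a [measurableType] has to be a [pointedType]. *)
#[short(type="pointedFinType")]
HB.structure Definition PointedFinite := {T of Finite T & Pointed T}.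

HB.instance Definition _ (S T : pointedFinType) := Finite.on (S * T)%type.

Definition conf (d : nat) (S : pointedFinType) : Type := Zd d -> S.

Section conf_structures.
Variables (d : nat) (S : pointedFinType).

HB.instance Definition _ := Topological.copy (conf d S)
  (prod_topology (fun _ : Zd d => discrete_topology S)).
HB.instance Definition _ := isPointed.Build (conf d S) (fun=> point).

Definition coordinate_events : set (set (conf d S)) :=
  [set A | exists (x : Zd d) (B : set S), A = [set w : conf d S | B (w x)]].

(* The product sigma-algebra. *)
HB.instance Definition _ :=
  Measurable.copy (conf d S) (g_sigma_algebraType coordinate_events).

End conf_structures.

Definition joint d (E E' : pointedFinType) (sigma : conf d E) (eta : conf d E') :
  conf d (E * E')%type := fun x => (sigma x, eta x).

(* [-n, n]^d; see [mem_box]. *)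
Definition box (d n : nat) : {fset Zd d} :=
  [fset [ffun i => (f i : nat)%:Z - n%:Z]
     | f : {ffun 'I_d -> 'I_(n.*2.+1)} in predT]%fset.

Lemma mem_box d n (x : Zd d) :
  (x \in box d n) = [forall i, (- n%:Z <= x i <= n%:Z)].
Proof.
apply/imfsetP/forallP => /= [[f _ ->] i|h].
  rewrite ffunE; have fi : (f i <= n + n)%N by rewrite addnn -ltnS ltn_ord.
  by rewrite lerBDr addNr lerBlDr -PoszD !lez_nat leq0n.
have xi i : 0 <= x i + n%:Z by have /andP[+ _] := h i; rewrite -subr_ge0 opprK.
have b i : (absz (x i + n%:Z)%R < n.*2.+1)%N.
  rewrite ltnS -lez_nat gez0_abs// -addnn PoszD lerD2r.
  by have /andP[] := h i.
exists [ffun i => Ordinal (b i)] => //.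
by apply/ffunP => i; rewrite !ffunE /= gez0_abs// addrK.
Qed.

(* Diameter for the sup-norm; the notion of finite range does not depend on the
   choice of a norm on R^d. *)
Definition diam d (A : {fset Zd d}) : nat :=
  \max_(x <- A) \max_(y <- A) \max_(i < d) absz (x i - y i)%R.

Section potential.
Variables (R : realType) (d : nat) (E E' : pointedFinType).

Definition potential := {fset Zd d} -> conf d (E * E')%type -> R.

Definition local_potential (Phi : potential) :=
  forall (A : {fset Zd d}) (xi xi' : conf d (E * E')%type),
    (forall x, x \in A -> xi x = xi' x) -> Phi A xi = Phi A xi'.

Definition finite_range (Phi : potential) :=
  exists r : nat, forall A : {fset Zd d}, (r < diam A)%N ->
    forall xi, Phi A xi = 0.

(* Every single Phi_A is bounded, being a function of finitely many finite-valued
   variables; the content is the uniformity in A.  Without it the boundary terms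
   need not be of surface order: for the Ising chain with couplings J_x growing
   like x^2, the + and - states have infinite relative entropy density. *)
Definition uniformly_bounded (Phi : potential) :=
  exists M : R, forall A xi, `|Phi A xi| <= M.

(* The configuration equal to [s] on L and to [sbar] off L. *)
Definition glue (L : {fset Zd d}) (s : {ffun L -> E}) (sbar : conf d E) :
  conf d E := fun x => if insub x is Some u then s u else sbar x.

(* For a finite range potential the set of nonzero terms is finite, so that the
   sum of finitely supported families of [fsbigop] applies. *)
Definition energy (Phi : potential) (L : {fset Zd d}) (sigma : conf d E)
    (eta : conf d E') : R :=
  \sum_(A \in [set A : {fset Zd d} | (A `&` L)%fset != fset0])
    Phi A (joint sigma eta).

Definition partition_function (Phi : potential) (L : {fset Zd d})
    (sbar : conf d E) (eta : conf d E') : R :=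
  \sum_(s : {ffun L -> E}) expR (- energy Phi L (glue s sbar) eta).

Definition quenched_gibbs (Phi : potential) (L : {fset Zd d})
    (sbar : conf d E) (eta : conf d E') (B : set (conf d E)) : R :=
  (partition_function Phi L sbar eta)^-1 *
  \sum_(s : {ffun L -> E})
     \1_B (glue s sbar) * expR (- energy Phi L (glue s sbar) eta).

(* KL is the measure P(d eta) mu_L^sbar[eta](d sigma). *)
Definition finite_volume_joint_measure (Phi : potential)
    (P : probability (conf d E') R) (sbar : conf d E) (L : {fset Zd d})
    (KL : probability (conf d (E * E')%type) R) :=
  forall B : set (conf d (E * E')%type), measurable B ->
    KL B = (\int[P]_eta
      (quenched_gibbs Phi L sbar eta [set sigma | B (joint sigma eta)])%:E)%E.

End potential.

Definition exhausting d (L : nat -> {fset Zd d}) :=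
  (forall N, (L N `<=` L N.+1)%fset) /\ (forall x, exists N, x \in L N).

Definition weak_limit (R : realType) d (S : pointedFinType)
    (KN : nat -> probability (conf d S) R) (K : probability (conf d S) R) :=
  forall f : conf d S -> R, continuous f -> (exists M, forall xi, `|f xi| <= M) ->
    (\int[KN N]_xi (f xi)%:E)%E @[N --> \oo] --> (\int[K]_xi (f xi)%:E)%E.

Definition joint_measure (R : realType) d (E E' : pointedFinType)
    (Phi : potential R d E E') (P : probability (conf d E') R)
    (sbar : conf d E) (L : nat -> {fset Zd d})
    (K : probability (conf d (E * E')%type) R) :=
  exhausting L /\
  exists KN : nat -> probability (conf d (E * E')%type) R,
    (forall N, finite_volume_joint_measure Phi P sbar (L N) (KN N)) /\
    weak_limit KN K.

Section relative_entropy.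
Variables (R : realType) (d : nat) (S : pointedFinType).
Implicit Types K : probability (conf d S) R.

Definition restrict_conf (L : {fset Zd d}) (xi : conf d S) : {ffun L -> S} :=
  [ffun u => xi (val u)].

Definition marginal K (L : {fset Zd d}) (B : set {ffun L -> S}) : R :=
  fine (K (@restrict_conf L @^-1` B)).

Definition marginal_abs_continuous (L : {fset Zd d}) K K' :=
  forall B : set {ffun L -> S}, marginal K' B = 0 -> marginal K B = 0.

(* The conventions [ln 0 = 0] and [x / 0 = 0] only intervene, under absolute
   continuity, for configurations with K-probability 0, whose term is 0. *)
Definition relative_entropy (L : {fset Zd d}) K K' : \bar R :=
  if `[< marginal_abs_continuous L K K' >] then
    (\sum_(x : {ffun L -> S})
       marginal K [set x] * ln (marginal K [set x] / marginal K' [set x]))%:E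
  else +oo%E.

Definition entropy_per_site K K' (n : nat) : \bar R :=
  ((#|` box d n|%:R^-1)%:E * relative_entropy (box d n) K K')%E.

Definition relative_entropy_density K K' : \bar R :=
  limn (entropy_per_site K K').

End relative_entropy.

(* Main.v *)
Require Import Defs.
From mathcomp Require Import all_boot all_order all_algebra finmap.
From mathcomp Require Import all_classical all_reals all_analysis.
From mathcomp Require Import zify ring lra.

(** The two joint measures are both compared with one reference, in which the
    box decouples from the rest of the lattice.

    Fix a box Lam and a larger volume L.  Sort the interactions A that meet L:
    those inside Lam make up [free_energy], those disjoint from Lam make up
    [outer_energy], and the remaining ones straddle the boundary of Lam.  By
    finite range a straddling A contributes only if it has a site in a shell of
    fixed width along the boundary, so by uniform boundedness the straddling
    terms amount to at most C = O(|shell|), whatever the spins and the disorder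
    ([energy_split_bound]).  Without them the Gibbs weight is a function of the
    configuration in Lam times a function of the configuration off Lam; the
    second factor cancels between numerator and partition function.  Hence,
    uniformly in L, in the boundary condition and in the disorder off Lam, the
    quenched probability of a spin pattern in Lam equals its free-boundary
    Gibbs probability up to a factor in [e^(-2C), e^(2C)], one e^C coming from
    the numerator and one from the partition function
    ([gibbs_marginal_bounds]).

    Since the free-boundary probability depends on the disorder in Lam only, it
    leaves the integral against P: the mass of a joint cylinder x is, up to
    e^(2C), the quantity [decoupled_mass] x, which knows neither the boundary
    condition nor the volumes.  Cylinders are clopen, so the bounds pass to the
    weak limits ([joint_measure_cylinder_bounds]).  The cylinder probabilities
    of K and K' thus differ by a factor of at most e^(4C), which bounds their
    relative entropy in Lam by 4C ([relative_entropy_comparable]).  As the shell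
    has surface order, C / |Lam| tends to 0 ([shell_ratio_le]).

    The law P enters only through the factor P(eta agrees with x in Lam), which
    K and K' share; a disorder pattern that P forbids has mass 0 under both, so
    absolute continuity is part of the comparison. *)

Set Implicit Arguments.
Unset Strict Implicit.
Unset Printing Implicit Defensive.

Import Order.TTheory GRing.Theory Num.Theory.
Import numFieldNormedType.Exports.

Local Open Scope classical_set_scope.
Local Open Scope ring_scope.

(* The name also denotes the gluing of two functions along classical sets. *)
Local Notation glue := Defs.glue.

(** * Boxes, shells and sets of small diameter *)

Lemma absz_le (k : int) (r : nat) : (absz k <= r)%N = (- r%:Z <= k <= r%:Z).
Proof. lia. Qed.

Section geometry.
Variable d : nat.
Implicit Types (A D : {fset Zd d}) (n r : nat).

Lemma diam_ge A x y i : x \in A -> y \in A -> (absz (x i - y i)%R <= diam A)%N.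
Proof.
move=> xA yA; rewrite /diam.
apply: leq_trans (leq_bigmax_seq _ xA isT).
apply: leq_trans (leq_bigmax_seq _ yA isT).
by rewrite (bigD1 i)// leq_maxl.
Qed.

Definition translate (x : Zd d) A : {fset Zd d} := [fset (x + z)%R | z in A]%fset.

(** A finite family that contains every set of diameter at most r with a site in
    D; it makes sums over interactions finite, and its cardinality is linear in
    that of D. *)
Definition small_sets_near r D : {fset {fset Zd d}} :=
  [fset translate x B | x in D, B in fpowerset (box d r)]%fset.

Lemma mem_small_sets_near r D A x : x \in D -> x \in A -> (diam A <= r)%N ->
  A \in small_sets_near r D.
Proof.
move=> xD xA dA; apply/imfset2P; exists x => //=.
exists [fset (y - x)%R | y in A]%fset.
  rewrite /= fpowersetE; apply/fsubsetP => _ /imfsetP[y /= yA ->].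
  rewrite mem_box; apply/forallP => i; rewrite !ffunE.
  by rewrite -absz_le; exact: leq_trans (diam_ge i yA xA) dA.
apply/fsetP => y; apply/idP/imfsetP => [yA|[_ /imfsetP[z /= zA ->] ->]].
  by exists (y - x); [exact: in_imfset|rewrite addrC subrK].
by rewrite addrC subrK.
Qed.

Lemma card_small_sets_near r D :
  (#|` small_sets_near r D| <= #|` D| * 2 ^ #|` box d r|)%N.
Proof.
rewrite /small_sets_near Imfset.imfset2E size_seq_fset.
by rewrite (leq_trans (size_undup _))// size_allpairs -card_fpowerset.
Qed.

Lemma card_box n : #|` box d n| = (n.*2.+1 ^ d)%N.
Proof.
rewrite card_imfset/=; last first.
  move=> f g /ffunP fg; apply/ffunP => i; apply/val_inj.
  by have := fg i; rewrite !ffunE /=; lia.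
by rewrite -cardE card_ffun !card_ord.
Qed.

Definition shell n r : {fset Zd d} := (box d n `\` box d (n - r)%N)%fset.

Lemma subset_box m n : (m <= n)%N -> (box d m `<=` box d n)%fset.
Proof.
move=> mn; apply/fsubsetP => x; rewrite !mem_box => /forallP h.
by apply/forallP => i; rewrite -absz_le (leq_trans _ mn)// absz_le h.
Qed.

(** A straddling set has a site outside the box; any of its sites in the box is
    within r of that one, hence outside the box of radius n - r. *)
Lemma straddling_meets_shell n r A : (r <= n)%N -> (diam A <= r)%N ->
  (A `&` box d n)%fset != fset0 -> ~~ (A `<=` box d n)%fset ->
  exists2 x, x \in shell n r & x \in A.
Proof.
move=> rn dA /fset0Pn[x]; rewrite inE => /andP[xA xn] /fsubsetPn[z zA zn].
exists x => //; rewrite inE xn andbT.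
move: zn; rewrite !mem_box => /forallPn[i zi].
apply/forallPn; exists i; move: zi; apply: contraNN.
have := leq_trans (diam_ge i xA zA) dA; rewrite -!absz_le.
by move: (x i) (z i) => a b /=; lia.
Qed.

End geometry.

(** * Splitting the energy along the boundary of a box *)

Section energies.
Variables (R : realType) (d : nat) (E E' : pointedFinType).
Variable Phi : potential R d E E'.
Implicit Types (A D L Lam : {fset Zd d}) (xi : conf d (E * E')%type).

Definition agree_on (S : pointedFinType) (B : pred (Zd d)) (w w' : conf d S) :=
  forall x, B x -> w x = w' x.

Lemma finite_interaction_sum (r : nat) D (p : pred {fset Zd d}) xi :
  (forall A, (r < diam A)%N -> forall xi, Phi A xi = 0) ->
  (forall A, p A -> (diam A <= r)%N -> exists2 x, x \in D & x \in A) ->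
  \sum_(A \in [set A | p A]) Phi A xi =
  \sum_(A <- small_sets_near r D | p A) Phi A xi.
Proof.
move=> Phir pD; rewrite (fsbigE [seq A <- small_sets_near r D | p A]).
- rewrite big_filter_cond; apply: eq_bigl => A.
  by rewrite mem_setE andbb.
- by rewrite filter_uniq// fset_uniq.
- by move=> A; rewrite /= mem_filter => /andP[].
move=> A /= pA; rewrite mem_filter pA /= => AD.
have [dA|rA] := leqP (diam A) r; last exact: Phir.
have [x xD xA] := pD _ pA dA.
by rewrite (mem_small_sets_near xD xA dA) in AD.
Qed.

Definition free_energy Lam xi : R :=
  \sum_(A \in [set A : {fset Zd d} | (A != fset0) && (A `<=` Lam)%fset]) Phi A xi.

Definition outer_energy Lam L xi : R :=
  \sum_(A \in [set A : {fset Zd d} |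
      ((A `&` L)%fset != fset0) && ((A `&` Lam)%fset == fset0)]) Phi A xi.

Hypothesis Phi_local : local_potential Phi.

Lemma free_energy_local Lam xi xi' : agree_on (mem Lam) xi xi' ->
  free_energy Lam xi = free_energy Lam xi'.
Proof.
move=> e; apply: eq_fsbigr => A; rewrite inE /= => /andP[_ /fsubsetP AL].
by apply: Phi_local => x xA; apply: e; exact: AL.
Qed.

Lemma outer_energy_local Lam L xi xi' : agree_on (predC (mem Lam)) xi xi' ->
  outer_energy Lam L xi = outer_energy Lam L xi'.
Proof.
move=> e; apply: eq_fsbigr => A; rewrite inE /= => /andP[_ /eqP AL].
apply: Phi_local => x xA; apply: e; apply/negP => /= xL.
by have := in_fset0 x; rewrite -AL inE xA xL.
Qed.

(** The difference is the sum over the interactions that straddle the boundary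
    of Lam.  The set D is any set of sites that all of them meet, and the bound
    is uniform in L, which is what allows L to exhaust the lattice. *)
Lemma energy_split_bound (r : nat) (M : R) Lam L D sigma eta :
    (forall A, (r < diam A)%N -> forall xi, Phi A xi = 0) ->
    (forall A xi, `|Phi A xi| <= M) ->
    (Lam `<=` L)%fset ->
    (forall A, (diam A <= r)%N -> (A `&` Lam)%fset != fset0 ->
       ~~ (A `<=` Lam)%fset -> exists2 x, x \in D & x \in A) ->
  `|energy Phi L sigma eta -
    (free_energy Lam (joint sigma eta) + outer_energy Lam L (joint sigma eta))|
    <= M * #|` small_sets_near r D|%:R.
Proof.
move=> Phir PhiM LamL HD; set xi := joint sigma eta.
have nz A : (A `&` L)%fset != fset0 -> exists2 x, x \in L & x \in A.
  by move=> /fset0Pn[x]; rewrite inE => /andP[xA xL]; exists x.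
have sub A : (A != fset0) && (A `<=` Lam)%fset -> (A `&` L)%fset != fset0.
  move=> /andP[/fset0Pn[x xA] /fsubsetP AL]; apply/fset0Pn; exists x.
  by rewrite inE xA (fsubsetP LamL)// AL.
have meet A : (A `&` Lam)%fset != fset0 -> (A `&` L)%fset != fset0.
  move=> /fset0Pn[x]; rewrite inE => /andP[xA xL]; apply/fset0Pn; exists x.
  by rewrite inE xA (fsubsetP LamL).
pose straddle A := ((A `&` Lam)%fset != fset0) && ~~ (A `<=` Lam)%fset.
(* What is left after the cancellation are the straddling interactions. *)
suff -> : energy Phi L sigma eta - (free_energy Lam xi + outer_energy Lam L xi) =
    \sum_(A \in [set A | straddle A]) Phi A xi.
  rewrite (finite_interaction_sum (D := D) _ Phir); last first.
    by move=> A /andP[A1 A2] dA; exact: HD.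
  rewrite (le_trans (ler_norm_sum _ _ _))//.
  rewrite (le_trans (ler_sum _ (fun A _ => PhiM A xi)))//.
  rewrite big_const_seq iter_addr_0 -[leLHS]mulr_natr ler_wpM2l//.
    exact: le_trans (PhiM fset0 xi).
  by rewrite ler_nat count_size.
(* All three sums become sums over one finite family, to be split by cases. *)
rewrite /energy /free_energy /outer_energy.
rewrite !(finite_interaction_sum (D := L) _ Phir); first last.
- by move=> A /nz.
- by move=> A /sub/nz.
- by move=> A /andP[/nz].
- by move=> A /andP[/meet/nz].
rewrite -/xi (bigID (fun A : {fset Zd d} => (A `&` Lam)%fset == fset0))/=.
rewrite [X in _ + X - _](bigID (fun A : {fset Zd d} => (A `<=` Lam)%fset))/=.
rewrite [X in _ - (X + _)](eq_bigl (fun A : {fset Zd d} =>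
  [&& (A `&` L)%fset != fset0, (A `&` Lam)%fset != fset0 & (A `<=` Lam)%fset])); last first.
  move=> A; apply/idP/idP => [/[dup] /sub -> /andP[A0 AL]|].
    by rewrite AL (fsetIidPl AL) A0.
  move=> /and3P[_ A1 A2]; rewrite A2 andbT; apply: contraNN A1 => /eqP ->.
  by rewrite fset0I.
rewrite [RHS](eq_bigl (fun A : {fset Zd d} =>
  ((A `&` L)%fset != fset0) && ((A `&` Lam)%fset != fset0) && ~~ (A `<=` Lam)%fset)); last first.
  move=> A; rewrite /straddle -andbA; case: ((A `&` Lam)%fset =P fset0) => /=.
    by rewrite andbF.
  by move=> /eqP /meet ->.
rewrite [X in _ - (X + _)](eq_bigl _ _ (fun A => andbA _ _ _)).
by ring.
Qed.

End energies.

(** * Overwriting part of a configuration *)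

Section gluing.
Variables (d : nat) (S : pointedFinType).
Implicit Types (L Lam : {fset Zd d}) (w : conf d S).

Lemma glue_in L (s : {ffun L -> S}) w x (xL : x \in L) :
  glue s w x = s [` xL]%fset.
Proof. by rewrite /glue insubT. Qed.

Lemma glue_out L (s : {ffun L -> S}) w x : x \notin L -> glue s w x = w x.
Proof. by move=> xL; rewrite /glue insubN. Qed.

Lemma restrict_confP L w w' :
  restrict_conf L w = restrict_conf L w' <-> agree_on (mem L) w w'.
Proof.
split=> [/ffunP e x xL|e].
  by have := e [` xL]%fset; rewrite !ffunE.
by apply/ffunP => u; rewrite !ffunE; apply: e; exact: valP.
Qed.

Lemma restrict_glue L (s : {ffun L -> S}) w : restrict_conf L (glue s w) = s.
Proof. by apply/ffunP => u; rewrite ffunE /glue valK. Qed.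

Lemma glue_restrict L w w' : agree_on (predC (mem L)) w w' ->
  glue (restrict_conf L w) w' = w.
Proof.
move=> e; apply/funext => x; have [xL|xL] := boolP (x \in L).
  by rewrite glue_in ffunE.
by rewrite glue_out// e.
Qed.

(** Spin configurations in L are summed over by first fixing the pattern in Lam.
    Overwriting that pattern identifies the configurations with one pattern and
    those with another, without splitting L into Lam and its complement. *)
Definition overwrite Lam L w (a : {ffun Lam -> S}) (s : {ffun L -> S}) :
  {ffun L -> S} := restrict_conf L (glue a (glue s w)).

Lemma glue_overwrite Lam L w (a : {ffun Lam -> S}) (s : {ffun L -> S}) :
  (Lam `<=` L)%fset -> glue (overwrite w a s) w = glue a (glue s w).
Proof.
move=> LamL; apply: glue_restrict => x /= xL.
by rewrite !glue_out//; apply: contraNN xL => /(fsubsetP LamL).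
Qed.

Lemma overwriteK Lam L w (a b : {ffun Lam -> S}) (s : {ffun L -> S}) :
  (Lam `<=` L)%fset ->
  restrict_conf Lam (glue s w) = a -> overwrite w a (overwrite w b s) = s.
Proof.
move=> LamL <-; rewrite /overwrite -/(overwrite w b s) glue_overwrite//.
rewrite -[RHS](restrict_glue s w); congr restrict_conf; apply: glue_restrict.
by move=> x /= xL; rewrite [RHS]glue_out.
Qed.

End gluing.

(** * Quenched Gibbs marginals in a box *)

Section decoupling.
Variables (R : realType) (d : nat) (E E' : pointedFinType).
Variable Phi : potential R d E E'.
Implicit Types (L Lam : {fset Zd d}).

(** The Gibbs probability of the pattern a under free boundary conditions: the
    spins off Lam are set to a default value, which [free_energy] ignores. *)
Definition free_gibbs Lam (a : {ffun Lam -> E}) (eta : conf d E') : R :=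
  expR (- free_energy Phi Lam (joint (glue a (fun=> point)) eta)) /
  \sum_(b : {ffun Lam -> E})
     expR (- free_energy Phi Lam (joint (glue b (fun=> point)) eta)).

Hypothesis Phi_local : local_potential Phi.
Variables (Lam L : {fset Zd d}) (LamL : (Lam `<=` L)%fset).
Variables (sbar : conf d E) (eta : conf d E') (C : R).
Hypothesis energyC : forall sigma, `|energy Phi L sigma eta -
  (free_energy Phi Lam (joint sigma eta) + outer_energy Phi Lam L (joint sigma eta))|
  <= C.

Let inner (a : {ffun Lam -> E}) : R :=
  expR (- free_energy Phi Lam (joint (glue a (fun=> point)) eta)).
Let outer (s : {ffun L -> E}) : R :=
  expR (- outer_energy Phi Lam L (joint (glue s sbar) eta)).
Let weight (s : {ffun L -> E}) : R := expR (- energy Phi L (glue s sbar) eta).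
Let spins (s : {ffun L -> E}) : {ffun Lam -> E} := restrict_conf Lam (glue s sbar).

Let weight_bounds s :
  expR (- C) * (inner (spins s) * outer s) <= weight s <=
  expR C * (inner (spins s) * outer s).
Proof.
have -> : inner (spins s) = expR (- free_energy Phi Lam (joint (glue s sbar) eta)).
  congr (expR (- _)); apply: free_energy_local => // x xL.
  by rewrite /joint glue_in ffunE.
rewrite /outer /weight -!expRD !ler_expR.
by have := energyC (glue s sbar); rewrite ler_norml => /andP[]; lra.
Qed.

(** Overwriting the pattern in Lam does not affect the outer energy. *)
Let outer_sum_indep (a b : {ffun Lam -> E}) :
  \sum_(s | spins s == a) outer s = \sum_(s | spins s == b) outer s.
Proof.
have so c s : spins (overwrite sbar c s) = c.
  by rewrite /spins glue_overwrite// restrict_glue.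
rewrite (reindex_onto (overwrite sbar a) (overwrite sbar b)); last first.
  by move=> s /eqP; exact: overwriteK.
apply: eq_big => [s|s _].
  rewrite so eqxx /=; apply/eqP/eqP => [<-|]; first by rewrite so.
  exact: overwriteK.
congr (expR (- _)); apply: outer_energy_local => // x /= xL.
by rewrite /joint glue_overwrite// glue_out.
Qed.

(** With I the sum of the inner weights and T the common sum of the outer ones,
    the numerator is within e^(+-C) of inner a * T and the partition function
    within e^(+-C) of I * T; the factor T cancels in the quotient. *)
Lemma gibbs_marginal_bounds (a : {ffun Lam -> E}) :
  expR (- (2 * C)) * free_gibbs a eta <=
  (\sum_(s : {ffun L -> E} | restrict_conf Lam (glue s sbar) == a)
     expR (- energy Phi L (glue s sbar) eta)) / partition_function Phi L sbar eta
  <= expR (2 * C) * free_gibbs a eta.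
Proof.
pose T := \sum_(s | spins s == a) outer s.
have T0 : 0 < T.
  rewrite /T (bigD1 (restrict_conf L (glue a sbar)))/=; last first.
    rewrite /spins glue_restrict ?restrict_glue// => x /= xL.
    by rewrite glue_out//; apply: contraNN xL => /(fsubsetP LamL).
  by rewrite ltr_pwDl ?expR_gt0// sumr_ge0// => s _; rewrite expR_ge0.
have bounds b : expR (- C) * (inner b * T) <= \sum_(s | spins s == b) weight s
    <= expR C * (inner b * T).
  rewrite /T (outer_sum_indep a b) !mulr_sumr; apply/andP; split;
    by apply: ler_sum => s /eqP <-; case/andP: (weight_bounds s).
pose I := \sum_b inner b.
have I0 : 0 < I.
  rewrite /I (bigD1 a)//= ltr_pwDl ?expR_gt0// sumr_ge0// => b _.
  by rewrite expR_ge0.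
have ZE : partition_function Phi L sbar eta = \sum_b \sum_(s | spins s == b) weight s.
  by rewrite /partition_function (partition_big spins xpredT).
have ZI : expR (- C) * (I * T) <= partition_function Phi L sbar eta <= expR C * (I * T).
  rewrite ZE /I mulr_suml !mulr_sumr; apply/andP; split;
    by apply: ler_sum => b _; case/andP: (bounds b).
have Z0 : 0 < partition_function Phi L sbar eta.
  by case/andP: ZI => + _; apply: lt_le_trans; rewrite !mulr_gt0 ?expR_gt0.
have eC : expR (- C) * expR C = 1 by rewrite -expRD addNr expR0.
rewrite /free_gibbs -/(inner a) -/I -/(weight _).
rewrite mulr2n mulrDl mul1r opprD !expRD.
case/andP: ZI => Z1 Z2; case/andP: (bounds a); rewrite -/T => N1 N2.
apply/andP; split.
  rewrite ler_pdivlMr// (le_trans _ N1)//.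
  rewrite -!mulrA ler_pM2l ?expR_gt0//.
  rewrite (@le_trans _ _ (expR (- C) * (inner a * (I^-1 * (expR C * (I * T))))))//.
    by rewrite !ler_wpM2l ?expR_ge0// invr_ge0 ltW.
  have -> : expR (- C) * (inner a * (I^-1 * (expR C * (I * T)))) =
     (expR (- C) * expR C) * (I^-1 * I) * (inner a * T) by ring.
  by rewrite eC mulVf ?gt_eqF// !mul1r.
rewrite ler_pdivrMr// (le_trans N2)//.
rewrite -!mulrA ler_pM2l ?expR_gt0//.
rewrite (@le_trans _ _ (expR C * (inner a * (I^-1 * (expR (- C) * (I * T))))))//.
  have -> : expR C * (inner a * (I^-1 * (expR (- C) * (I * T)))) =
     (expR (- C) * expR C) * (I^-1 * I) * (inner a * T) by ring.
  by rewrite eC mulVf ?gt_eqF// !mul1r.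
by rewrite !ler_wpM2l ?expR_ge0// invr_ge0 ltW.
Qed.

End decoupling.

(** * Cylinder probabilities of joint measures *)

Section cylinders.
Variables (d : nat) (S : pointedFinType).
Implicit Types (Lam : {fset Zd d}).

Definition cylinder Lam (x : {ffun Lam -> S}) : set (conf d S) :=
  @restrict_conf d S Lam @^-1` [set x].

Lemma measurable_cylinder Lam (x : {ffun Lam -> S}) : measurable (cylinder x).
Proof.
rewrite (_ : cylinder x =
  \bigcap_(u in [set: Lam]) [set w : conf d S | w (val u) = x u]); last first.
  apply/seteqP; split => [w <- u _|w xw] /=; first by rewrite ffunE.
  by apply/ffunP => u; rewrite ffunE; exact: xw.
apply: fin_bigcap_measurable; first exact: finite_finset.
move=> u _; apply: sub_sigma_algebra.
by exists (val u), [set s | s = x u].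
Qed.

(** A cylinder depends on finitely many coordinates with discrete values, so its
    indicator is locally constant and may serve as a test function for weak
    convergence. *)
Lemma continuous_cylinder (R : realType) Lam (x : {ffun Lam -> S}) :
  continuous (\1_(cylinder x) : conf d S -> R).
Proof.
move=> w; have FF := @nbhs_filter (conf d S) w; apply: (@cvg_near_cst _ _ _ _ _ FF).
have loc (u : Lam) : \forall w' \near w, w' (val u) = w (val u).
  exact: (@proj_continuous _ (fun _ : Zd d => discrete_topology S) (val u) w
    _ (@discrete_set1 (discrete_topology S) (w (val u)))).
apply: filterS (filter_forall FF loc) => w' ww'.
have e : restrict_conf Lam w' = restrict_conf Lam w.
  by apply/ffunP => u; rewrite !ffunE.
rewrite !indicE; congr (_%:R); congr (nat_of_bool _).
by apply/idP/idP; rewrite !inE /cylinder /= e.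
Qed.

End cylinders.

(** The integral of a nonnegative function is a supremum over the simple functions
    below it, hence monotone even on functions that are not known to be
    measurable.  This spares a proof that the quenched Gibbs probability is
    measurable in the disorder. *)
Lemma ge0_integral_mono dT (T : measurableType dT) (R : realType)
    (mu : {measure set T -> \bar R}) (f g : T -> \bar R) :
  (forall x, 0 <= f x)%E -> (forall x, f x <= g x)%E ->
  (\int[mu]_x f x <= \int[mu]_x g x)%E.
Proof.
move=> f0 fg; have g0 x : (0 <= g x)%E by exact: le_trans (fg x).
rewrite !ge0_integralE// !patch_setT; apply: ereal_sup_le => _ [h /= hf <-].
by exists h => // x; exact: le_trans (fg x).
Qed.

Section joint_measures.
Variables (R : realType) (d : nat) (E E' : pointedFinType).
Variable Phi : potential R d E E'.
Hypothesis Phi_local : local_potential Phi.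
Variable P : probability (conf d E') R.
Implicit Types (L Lam : {fset Zd d}).

Definition spin_part Lam (x : {ffun Lam -> (E * E')%type}) : {ffun Lam -> E} :=
  [ffun u => (x u).1].

Definition disorder_part Lam (x : {ffun Lam -> (E * E')%type}) :
  {ffun Lam -> E'} := [ffun u => (x u).2].

Definition decoupled_weight Lam (x : {ffun Lam -> (E * E')%type}) : R :=
  free_gibbs Phi (spin_part x) (glue (disorder_part x) (fun=> point)).

(** The reference that both joint measures are compared with. *)
Definition decoupled_mass Lam (x : {ffun Lam -> (E * E')%type}) : R :=
  decoupled_weight x * fine (P (cylinder (disorder_part x))).

Lemma free_gibbs_ge0 Lam (a : {ffun Lam -> E}) eta : 0 <= free_gibbs Phi a eta.
Proof. by rewrite divr_ge0 ?expR_ge0 ?sumr_ge0// => *; rewrite expR_ge0. Qed.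

(** This is why the free-boundary weight can be taken out of the integral over the
    disorder: on the event that the disorder in Lam is given, it is constant. *)
Lemma free_gibbs_local Lam (a : {ffun Lam -> E}) eta eta' :
  agree_on (mem Lam) eta eta' -> free_gibbs Phi a eta = free_gibbs Phi a eta'.
Proof.
move=> e; rewrite /free_gibbs.
have fe b : free_energy Phi Lam (joint (glue b (fun=> point)) eta) =
    free_energy Phi Lam (joint (glue b (fun=> point)) eta').
  by apply: free_energy_local => // x xL; rewrite /joint e.
by rewrite fe; congr (_ / _); apply: eq_bigr => b _; rewrite fe.
Qed.

Lemma joint_in_cylinder Lam (x : {ffun Lam -> (E * E')%type}) sigma eta :
  cylinder x (joint sigma eta) <->
  cylinder (spin_part x) sigma /\ cylinder (disorder_part x) eta.
Proof.
rewrite /cylinder /=; split=> [<-|[/ffunP h1 /ffunP h2]].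
  by split; apply/ffunP => u; rewrite !ffunE.
apply/ffunP => u; have := h1 u; have := h2 u; rewrite !ffunE /joint => -> ->.
by rewrite -surjective_pairing.
Qed.

Section finite_volume.
Variables (Lam L : {fset Zd d}) (LamL : (Lam `<=` L)%fset).
Variables (sbar : conf d E) (C : R).
Hypothesis energyC : forall sigma eta, `|energy Phi L sigma eta -
  (free_energy Phi Lam (joint sigma eta) + outer_energy Phi Lam L (joint sigma eta))|
  <= C.

Lemma quenched_cylinder_bounds (x : {ffun Lam -> (E * E')%type}) eta :
  expR (- (2 * C)) * decoupled_weight x * \1_(cylinder (disorder_part x)) eta <=
  quenched_gibbs Phi L sbar eta [set sigma | cylinder x (joint sigma eta)]
  <= expR (2 * C) * decoupled_weight x * \1_(cylinder (disorder_part x)) eta.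
Proof.
have [eb|eb] := pselect (cylinder (disorder_part x) eta); last first.
  rewrite indicE memNset// !mulr0 /quenched_gibbs big1 ?mulr0 ?lexx// => s _.
  by rewrite indicE memNset ?mul0r//= => /joint_in_cylinder[].
rewrite indicE mem_set// !mulr1 /decoupled_weight (@free_gibbs_local _ _ _ eta); last first.
  by apply/restrict_confP; rewrite restrict_glue; exact: esym eb.
suff -> : quenched_gibbs Phi L sbar eta [set sigma | cylinder x (joint sigma eta)] =
    (\sum_(s : {ffun L -> E} |
        restrict_conf Lam (glue s sbar) == spin_part x)
     expR (- energy Phi L (glue s sbar) eta)) / partition_function Phi L sbar eta.
  exact: gibbs_marginal_bounds.
rewrite /quenched_gibbs mulrC [X in _ = X / _]big_mkcond; congr (_ / _); apply: eq_bigr => s _.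
rewrite indicE; case: eqP => sx.
  by rewrite mem_set ?mul1r//; apply/joint_in_cylinder.
by rewrite memNset ?mul0r// => /joint_in_cylinder[].
Qed.

Lemma finite_volume_cylinder_bounds KL (x : {ffun Lam -> (E * E')%type}) :
  finite_volume_joint_measure Phi P sbar L KL ->
  ((expR (- (2 * C)) * decoupled_mass x)%:E <= KL (cylinder x)
   <= (expR (2 * C) * decoupled_mass x)%:E)%E.
Proof.
move=> /(_ _ (measurable_cylinder x)) ->.
have bounds := quenched_cylinder_bounds x.
rewrite /decoupled_mass; set b := disorder_part x in bounds *.
set m := decoupled_weight x in bounds *.
have m0 : 0 <= m by exact: free_gibbs_ge0.
(* Keeps the positivity rewrites below from unfolding the weight. *)
clearbody m.
have int c : 0 <= c -> (c * (m * fine (P (cylinder b))))%:E =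
    (\int[P]_eta (c * m * \1_(cylinder b) eta)%:E)%E.
  move=> c0; rewrite (integralZl_indic measurableT (fun=> cylinder b))//.
  - rewrite integral_indic//; last exact: measurable_cylinder.
    by rewrite setIT mulrA EFinM fineK// fin_num_measure//; exact: measurable_cylinder.
  - by rewrite ltNge mulr_ge0.
  - exact: measurable_cylinder.
rewrite !int ?expR_ge0//; apply/andP; split; apply: ge0_integral_mono => eta.
- by rewrite lee_fin !mulr_ge0 ?expR_ge0.
- by rewrite lee_fin; case/andP: (bounds eta).
- rewrite lee_fin; case/andP: (bounds eta) => + _; apply: le_trans.
  by rewrite !mulr_ge0 ?expR_ge0.
- by rewrite lee_fin; case/andP: (bounds eta).
Qed.

End finite_volume.

(** The constants do not depend on the volume, so that the finite-volume bounds,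
    which hold as soon as the volume contains Lam, survive in the limit. *)
Lemma joint_measure_cylinder_bounds Lam (sbar : conf d E) (Ls : nat -> {fset Zd d})
    K (C : R) (x : {ffun Lam -> (E * E')%type}) :
  (forall L, (Lam `<=` L)%fset -> forall sigma eta, `|energy Phi L sigma eta -
    (free_energy Phi Lam (joint sigma eta) +
     outer_energy Phi Lam L (joint sigma eta))| <= C) ->
  joint_measure Phi P sbar Ls K ->
  expR (- (2 * C)) * decoupled_mass x <= marginal K [set x]
  <= expR (2 * C) * decoupled_mass x.
Proof.
move=> energyC [[Lnd Lex] [KN [KNfin KNlim]]].
have LamLs : \forall N \near \oo, (Lam `<=` Ls N)%fset.
  have loc (u : Lam) : \forall N \near \oo, val u \in Ls N.
    have [N0 uN0] := Lex (val u); exists N0 => // N /= N0N.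
    apply: fsubsetP uN0; rewrite -(subnK N0N); elim: (N - N0)%N => //= k IH.
    by rewrite addSn (fsubset_trans IH).
  apply: filterS (filter_forall _ loc) => N LN.
  by apply/fsubsetP => y yLam; exact: (LN [` yLam]%fset).
have lim : KN N (cylinder x) @[N --> \oo] --> K (cylinder x).
  have := KNlim _ (@continuous_cylinder _ _ R _ x) _.
  have int (Q : probability (conf d (E * E')%type) R) :
      (\int[Q]_xi (\1_(cylinder x) xi)%:E)%E = Q (cylinder x).
    by rewrite integral_indic ?setIT//; exact: measurable_cylinder.
  rewrite int; under [X in X @ _]eq_fun do rewrite int; apply.
  by exists 1 => xi; rewrite indicE; case: (_ \in _); rewrite ?normr1 ?normr0.
rewrite -!lee_fin /marginal fineK ?fin_num_measure//; last exact: measurable_cylinder.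
apply/andP; split; [apply: cvge_to_ge lim _|apply: cvge_to_le lim _];
  apply: filterS LamLs => N LamLN;
  by have /andP[] := finite_volume_cylinder_bounds LamLN (energyC _ LamLN) x (KNfin N).
Qed.

End joint_measures.

(** * Relative entropy of comparable measures *)

Section entropy.
Variables (R : realType) (d : nat) (S : pointedFinType).
Implicit Types (K : probability (conf d S) R) (Lam : {fset Zd d}).

Lemma marginal_sum K Lam (B : set {ffun Lam -> S}) :
  marginal K B = \sum_(x | x \in B) marginal K [set x].
Proof.
have BE : @restrict_conf d S Lam @^-1` B = \bigcup_(x in B) cylinder x.
  apply/seteqP; split => [w Bw|w [x Bx xw]]; first by exists (restrict_conf Lam w).
  by rewrite /preimage /= (xw : restrict_conf Lam w = x).
rewrite /marginal BE measure_fin_bigcup; first last.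
- by move=> x _; exact: measurable_cylinder.
- by move=> x y _ _ [w [xw yw]]; rewrite -[LHS]xw -[RHS]yw.
- exact: finite_finset.
rewrite (fsbigE (enum (mem B))) ?enum_uniq//; first last.
- by move=> x Bx; rewrite mem_enum => /negP[]; exact/mem_set.
- by move=> x /=; rewrite mem_enum => /set_mem.
rewrite big_enum_cond/= (eq_bigl (fun x => x \in B)); last by move=> x; rewrite andbb.
rewrite -sum_fine// => x _; rewrite fin_num_measure//; exact: measurable_cylinder.
Qed.

Lemma marginal_ge0 K Lam (B : set {ffun Lam -> S}) : 0 <= marginal K B.
Proof. exact: fine_ge0. Qed.

Lemma marginal_total K Lam : \sum_(x : {ffun Lam -> S}) marginal K [set x] = 1.
Proof.
have <- : marginal K [set: {ffun Lam -> S}] = 1.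
  by rewrite /marginal preimage_setT probability_setT.
by rewrite marginal_sum; apply: eq_bigl => x; rewrite in_setT.
Qed.

(** The relative entropy averages ln (K(x) / K'(x)) over K, and each of these
    logarithms lies in [-c, c] as soon as K(x) > 0. *)
Lemma relative_entropy_comparable K K' Lam (c : R) :
  (forall x : {ffun Lam -> S},
     marginal K [set x] <= expR c * marginal K' [set x]) ->
  (forall x : {ffun Lam -> S},
     marginal K' [set x] <= expR c * marginal K [set x]) ->
  exists2 h : R, relative_entropy Lam K K' = h%:E & `|h| <= c.
Proof.
move=> KK' K'K.
have ac : marginal_abs_continuous Lam K K'.
  move=> B; rewrite !marginal_sum => /eqP.
  rewrite psumr_eq0; last by move=> x _; exact: marginal_ge0.
  move=> /allP B0; apply: big1 => x Bx; apply/eqP; rewrite eq_le marginal_ge0 andbT.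
  have /implyP/(_ Bx)/eqP q0 := B0 x (mem_index_enum x).
  by rewrite (le_trans (KK' x))// q0 mulr0.
rewrite /relative_entropy asboolT//; eexists; first by [].
rewrite (le_trans (ler_norm_sum _ _ _))//.
rewrite -[leRHS]mul1r -(marginal_total K Lam) mulr_suml; apply: ler_sum => x _.
set p := marginal K [set x]; set q := marginal K' [set x].
have p0 : 0 <= p by exact: marginal_ge0.
rewrite normrM (ger0_norm p0); have [p0'|pn0] := eqVneq p 0.
  by rewrite p0' !mul0r.
have pp : 0 < p by rewrite lt_def pn0.
have qp : 0 < q.
  by have := lt_le_trans pp (KK' x); rewrite pmulr_rgt0// expR_gt0.
rewrite ler_wpM2l// ler_norml -ler_expR -[X in _ && X]ler_expR.
rewrite lnK ?posrE ?divr_gt0// expRN ler_pdivlMr// ler_pdivrMr// KK' andbT.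
by rewrite mulrC ler_pdivrMr ?expR_gt0// mulrC K'K.
Qed.

End entropy.

(** * The shell has surface order *)

Section surface_order.
Variable R : realType.

Lemma bernoulli_gap (q : R) k : 0 <= q <= 1 -> 1 - q ^+ k <= k%:R * (1 - q).
Proof.
move=> /andP[q0 q1]; elim: k => [|k IH]; first by rewrite expr0 subrr mul0r.
have qk : q ^+ k <= 1 by rewrite exprn_ile1.
rewrite exprS -natr1; nra.
Qed.

(** With q = (2(n - r) + 1) / (2n + 1) the ratio is 1 - q^d, at most
    d (1 - q) = 2rd / (2n + 1).  The argument covers d = 0, where box and
    inner box coincide. *)
Lemma shell_ratio_le d r n : (r <= n)%N ->
  #|` box d n|%:R^-1 * #|` shell d n r|%:R <= (d * r.*2)%:R * harmonic n :> R.
Proof.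
move=> rn; rewrite cardfsDS ?subset_box ?leq_subr// !card_box.
rewrite natrB; last first.
  by case: (d) => // k; rewrite leq_exp2r// ltnS leq_double leq_subr.
have [b0 b1] : (0 < n.*2.+1%:R :> R) /\ (0 < n.+1%:R :> R) by rewrite !ltr0n.
rewrite !natrX mulrBr mulVf ?expf_neq0 ?gt_eqF// mulrC -expr_div_n.
set q := _ / _; have q1 : 1 - q = r.*2%:R / n.*2.+1%:R.
  rewrite /q doubleB -subSn ?leq_double// natrB; last by rewrite ltnW// ltnS leq_double.
  by field; rewrite gt_eqF.
have q01 : 0 <= q <= 1.
  by rewrite divr_ge0//= -subr_ge0 q1 divr_ge0.
rewrite (le_trans (bernoulli_gap d q01))// q1 natrM -mulrA.
by rewrite !ler_wpM2l// /harmonic lef_pV2 ?posrE// ler_nat ltnS -addnn leq_addr.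
Qed.

End surface_order.

(** * Vanishing of the relative entropy density *)

(** Each joint measure is within e^(+-2C) of the decoupled mass, whence the 4.
    The power of 2 counts the subsets of a translate of the box of radius r, that
    is, the interactions that may use a given site of the shell. *)
Lemma relative_entropy_le_shell (R : realType) (d : nat) (E E' : pointedFinType)
    (Phi : potential R d E E') (P : probability (conf d E') R)
    (sbar sbar' : conf d E) (L L' : nat -> {fset Zd d})
    (K K' : probability (conf d (E * E')%type) R) (r n : nat) (M : R) :
  local_potential Phi ->
  (forall A, (r < diam A)%N -> forall xi, Phi A xi = 0) ->
  (forall A xi, `|Phi A xi| <= M) ->
  joint_measure Phi P sbar L K -> joint_measure Phi P sbar' L' K' ->
  (r <= n)%N ->
  exists2 h : R, relative_entropy (box d n) K K' = h%:E &
    `|h| <= 4 * M * (2 ^ #|` box d r|)%:R * #|` shell d n r|%:R.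
Proof.
move=> loc Phir PhiM KJ K'J rn.
pose C := M * #|` small_sets_near r (shell d n r)|%:R.
have energyC L0 (LamL : (box d n `<=` L0)%fset) sigma eta : `|energy Phi L0 sigma eta -
    (free_energy Phi (box d n) (joint sigma eta) +
     outer_energy Phi (box d n) L0 (joint sigma eta))| <= C.
  apply: energy_split_bound => // A dA A1 A2; exact: straddling_meets_shell A2.
have M0 : 0 <= M by exact: le_trans (PhiM fset0 point).
have compare sb sb' Ls Ls' (Q Q' : probability (conf d (E * E')%type) R)
    (x : {ffun box d n -> (E * E')%type}) :
    joint_measure Phi P sb Ls Q -> joint_measure Phi P sb' Ls' Q' ->
  marginal Q [set x] <= expR (4 * C) * marginal Q' [set x].
  move=> QJ Q'J.
  have /andP[_ Qx] := joint_measure_cylinder_bounds loc x energyC QJ.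
  have /andP[Q'x _] := joint_measure_cylinder_bounds loc x energyC Q'J.
  rewrite (le_trans Qx)// (_ : 4 * C = 2 * C + 2 * C); last by ring.
  rewrite expRD -mulrA ler_pM2l ?expR_gt0//.
  by rewrite -ler_pdivrMl ?expR_gt0// -expRN.
have [h hE hC] := relative_entropy_comparable
  (fun x => compare _ _ _ _ _ _ x KJ K'J) (fun x => compare _ _ _ _ _ _ x K'J KJ).
exists h => //; rewrite (le_trans hC)// /C -!mulrA ler_wpM2l// ler_wpM2l//.
by rewrite -natrM ler_nat mulnC card_small_sets_near.
Qed.

Theorem theorem9 (R : realType) (d : nat) (E E' : pointedFinType)
    (Phi : potential R d E E') (P : probability (conf d E') R)
    (sbar sbar' : conf d E) (L L' : nat -> {fset Zd d})
    (K K' : probability (conf d (E * E')%type) R)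
    (Phi_local : local_potential Phi)
    (Phi_finite_range : finite_range Phi)
    (Phi_bounded : uniformly_bounded Phi)
    (K_joint : joint_measure Phi P sbar L K)
    (K'_joint : joint_measure Phi P sbar' L' K') :
  cvgn (entropy_per_site K K') /\ relative_entropy_density K K' = 0%E.
Proof.
have [r Phir] := Phi_finite_range; have [M PhiM] := Phi_bounded.
have M0 : 0 <= M by exact: le_trans (PhiM fset0 point).
suff lim0 : entropy_per_site K K' n @[n --> \oo] --> 0%:E.
  by split; [apply/cvg_ex; exists 0%:E|exact/cvg_lim].
pose B := 4 * M * (2 ^ #|` box d r|)%:R * (d * r.*2)%:R.
have B0 : 0 <= B by rewrite !mulr_ge0.
have bound n : (r <= n)%N -> exists2 e : R,
    entropy_per_site K K' n = e%:E & `|e| <= B * harmonic n.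
  move=> rn; have [h hE hb] :=
    relative_entropy_le_shell Phi_local Phir PhiM K_joint K'_joint rn.
  exists (#|` box d n|%:R^-1 * h); first by rewrite /entropy_per_site hE -EFinM.
  rewrite normrM ger0_norm ?invr_ge0//.
  rewrite (le_trans (ler_wpM2l _ hb)) ?invr_ge0// mulrCA /B -[leRHS]mulrA.
  by rewrite ler_wpM2l ?shell_ratio_le// !mulr_ge0.
apply: cvg_EFin.
  by exists r => // n /= /bound[e ->].
have Bh : B * harmonic n @[n --> \oo] --> (0 : R).
  by rewrite -(mulr0 B); apply: cvgMr; exact: cvg_harmonic.
apply: (squeeze_cvgr (f := fun n => - (B * harmonic n)) (h := fun n => B * harmonic n)) => //.
  by exists r => // n /= /bound[e -> /=]; rewrite ler_norml.
by rewrite -oppr0; exact: cvgN.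
Qed.
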